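(* For every integer $k\geq 2$, $\mathcal{L}(QFA_{k-1})\subset\mathcal{L}(QFA_k)$, where the inclusion is proper. Here $\mathcal{L}(QFA_j)$ denotes the class of languages accepted with bounded error by $j$-letter quantum finite automata.
   Context: Let $k\geq 1$. A $k$-letter quantum finite automaton ($k$-letter QFA) is a quintuple $\mathcal{A}=(Q,Q_{acc},|\psi_0\rangle,\Sigma,\mu)$, where $Q$ is a finite set of states, identified with an orthonormal basis of $\mathbb{C}^{|Q|}$; $Q_{acc}\subseteq Q$ is the set of accepting states; $|\psi_0\rangle\in\mathbb{C}^{|Q|}$ is a unit vector (initial state); $\Sigma$ is a finite input alphabet; and $\mu$ assigns to each string $w\in(\{\Lambda\}\cup\Sigma)^k$ a unitary matrix $\mu(w)$ on $\mathbb{C}^{|Q|}$, where $\Lambda\notin\Sigma$ is a blank symbol. For $x=\sigma_1\cdots\sigma_m\in\Sigma^*$, put $\sigma_j=\Lambda$ for $j\leq 0$ and define $\overline{\mu}(x)=\prod_{i=1}^m\mu(\sigma_{i-k+1}\sigma_{i-k+2}\cdots\sigma_i)$, the factors being ordered from left to right by increasing $i$ (and $\overline{\mu}$ of the empty string is the identity). Let $P_{acc}$ be the orthogonal projector onto the span of $Q_{acc}$. The accepting probability of $x$ is $P_{\mathcal{A}}(x)=\|\langle\psi_0|\overline{\mu}(x)P_{acc}\|^2$. A language $L\subseteq\Sigma^*$ is accepted by $\mathcal{A}$ with bounded error if there are $\lambda\in[0,1]$ and $\varepsilon>0$ such that $P_{\mathcal{A}}(x)\geq\lambda+\varepsilon$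 for all $x\in L$ and $P_{\mathcal{A}}(x)\leq\lambda-\varepsilon$ for all $x\in\Sigma^*\setminus L$. Languages over arbitrary finite alphabets are considered. *)

(* Defs.v *)
(* Complex numbers are R[i] for R : realType (MathComp, real-closed, reals). *)
From HB Require Import structures.
From mathcomp Require Import all_boot all_order all_algebra.
From mathcomp Require Import complex.
From mathcomp Require Import classical_sets reals.

Set Implicit Arguments.
Unset Strict Implicit.
Unset Printing Implicit Defensive.

Import Order.TTheory GRing.Theory Num.Theory.
Local Open Scope ring_scope.
Local Open Scope complex_scope.
Local Open Scope sesquilinear_scope.

(* The squared Euclidean norm when A is a row or a column vector. *)
Definition sqnorm (R : realType) (m n : nat) (A : 'M[R[i]]_(m, n)) : R :=
  \sum_i \sum_j ComplexField.Normc.normc (A i j) ^+ 2.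

(* Extended letters are elements of [option Sigma]; the blank is [None].
   The basis vector attached to a state q has index [enum_rank q]. *)
Record qfa (R : realType) (Sigma : finType) (k : nat) : Type := Qfa {
  qfa_state : finType;
  qfa_acc : {set qfa_state};
  qfa_init : 'cV[R[i]]_#|qfa_state|;
  qfa_mu : k.-tuple (option Sigma) -> 'M[R[i]]_#|qfa_state|;
  qfa_init_unit : sqnorm qfa_init = 1;
  qfa_mu_unitary : forall w, qfa_mu w \is unitarymx
}.

(* The letters of x are numbered from 1. Positions j <= 0 carry the blank; so
   do positions j > size x, which are never read below. *)
Definition letter (Sigma : finType) (x : seq Sigma) (j : int) : option Sigma :=
  if j is Posz p.+1 then onth x p else None.

(* The k extended letters of x at positions i - k + 1, ..., i. *)
Definition window (Sigma : finType) (k : nat) (x : seq Sigma) (i : nat) :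
    k.-tuple (option Sigma) :=
  [tuple letter x (i%:Z - k%:Z + 1 + (t : nat)%:Z) | t < k].

Definition mubar (R : realType) (Sigma : finType) (k : nat)
    (A : qfa R Sigma k) (x : seq Sigma) : 'M[R[i]]_#|qfa_state A| :=
  \big[mulmx/1%:M]_(1 <= i < (size x).+1) qfa_mu A (window k x i).

Definition proj_acc (R : realType) (Sigma : finType) (k : nat)
    (A : qfa R Sigma k) : 'M[R[i]]_#|qfa_state A| :=
  diag_mx (\row_j (enum_val j \in qfa_acc A)%:R).

Definition acc_prob (R : realType) (Sigma : finType) (k : nat)
    (A : qfa R Sigma k) (x : seq Sigma) : R :=
  sqnorm ((qfa_init A)^t* *m mubar A x *m proj_acc A).

Definition accepts_bounded_error (R : realType) (Sigma : finType) (k : nat)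
    (A : qfa R Sigma k) (L : set (seq Sigma)) : Prop :=
  exists lambda eps : R,
    [/\ 0 <= lambda <= 1, 0 < eps,
        forall x, L x -> lambda + eps <= acc_prob A x
      & forall x, ~ L x -> acc_prob A x <= lambda - eps].

(* A language comes with its alphabet, which may be any finite type. *)
Record language : Type := Language {
  alphabet : finType;
  strings : set (seq alphabet)
}.

(* A predicate rather than a [set]: the type [language] lives in a universe too
   large for [set]. *)
Definition L_QFA (R : realType) (k : nat) (L : language) : Prop :=
  exists A : qfa R (alphabet L) k, accepts_bounded_error A (@strings L).

(* Main.v *)
(* A k-letter automaton simulates a (k-1)-letter one by ignoring the first letter
   of each window.  The inclusion is strict already over a one-letter alphabet,
   for the language of words a^n with n >= m := k - 1.  The window (blank, a^m)
   is read exactly when the length reaches m, so a k-letter automaton with two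
   states can swap them at that moment.  An m-letter automaton, once it has read
   a^(m-1), applies the same unitary U at every further letter.  By pigeonhole
   some U^n with n > 0 nearly fixes the current vector, so that a^(m-1) and
   a^(m-1+n) are accepted with nearly the same probability, although only the
   second word is in the language. *)
Require Import Defs.
From mathcomp Require Import all_boot all_order all_algebra.
From mathcomp Require Import classical_sets reals.
From mathcomp Require Import perm fingroup complex zify ring lra.

Set Implicit Arguments.
Unset Strict Implicit.
Unset Printing Implicit Defensive.

Import Order.TTheory GRing.Theory Num.Theory.
Local Open Scope ring_scope.
Local Open Scope complex_scope.
Local Open Scope sesquilinear_scope.

(** * Squared norms of complex matrices *)

Lemma sqr_normc (R : realType) (z : R[i]) :
  ComplexField.Normc.normc z ^+ 2 = complex.Re z ^+ 2 + complex.Im z ^+ 2.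
Proof. by case: z => a b /=; rewrite sqr_sqrtr // addr_ge0 ?sqr_ge0. Qed.

(** In trace form, unitary invariance is the cancellation of [U] against its adjoint. *)
Lemma sqnorm_trace (R : realType) (m n : nat) (A : 'M[R[i]]_(m, n)) :
  (sqnorm A)%:C = \tr (A *m A^t*).
Proof.
rewrite /sqnorm /mxtrace rmorph_sum; apply: eq_bigr => i _.
rewrite rmorph_sum !mxE; apply: eq_bigr => j _.
rewrite !mxE sqr_normc; case: (A i j) => a b /=.
by simpc; congr (_ +i* _); ring.
Qed.

Lemma sqnorm_mul_unitary (R : realType) (m n : nat) (A : 'M[R[i]]_(m, n))
    (U : 'M[R[i]]_n) :
  U \is unitarymx -> sqnorm (A *m U) = sqnorm A.
Proof.
move=> U_unitary; apply: (@complexI R); rewrite !sqnorm_trace trmx_mul map_mxM.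
by rewrite mulmxA mulmxtVK.
Qed.

Lemma sqnorm_adj (R : realType) (m n : nat) (A : 'M[R[i]]_(m, n)) :
  sqnorm (A^t*) = sqnorm A.
Proof.
rewrite /sqnorm exchange_big; apply: eq_bigr => i _; apply: eq_bigr => j _.
by rewrite !mxE !sqr_normc; case: (A i j) => a b /=; rewrite sqrrN.
Qed.

(** A weighted triangle inequality, proved on real coordinates by completing a square. The weight
    [t] is free so that the factor of [sqnorm B] can be brought close to 1. *)
Lemma sqnorm_le_near (R : realType) (m n : nat) (A B : 'M[R[i]]_(m, n)) (t : R) :
  0 < t -> sqnorm A <= (1 + t) * sqnorm B + (1 + t^-1) * sqnorm (A - B).
Proof.
move=> t0.
have near (a b : R) : a ^+ 2 <= (1 + t) * b ^+ 2 + (1 + t^-1) * (a - b) ^+ 2.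
  rewrite -subr_ge0.
  have -> : (1 + t) * b ^+ 2 + (1 + t^-1) * (a - b) ^+ 2 - a ^+ 2
          = t^-1 * (t * b - (a - b)) ^+ 2 by field; exact: lt0r_neq0.
  by rewrite mulr_ge0 ?sqr_ge0 // invr_ge0 ltW.
rewrite /sqnorm !mulr_sumr -big_split; apply: ler_sum => i _ /=.
rewrite !mulr_sumr -big_split; apply: ler_sum => j _ /=.
rewrite !mxE !sqr_normc; case: (A i j) (B i j) => [a a'] [b b'] /=.
by have := near a b; have := near a' b'; lra.
Qed.

Lemma sqnorm_mul_proj_acc (R : realType) (Sigma : finType) (k m : nat)
    (A : qfa R Sigma k) (B : 'M[R[i]]_(m, #|qfa_state A|)) :
  sqnorm (B *m proj_acc A) <= sqnorm B.
Proof.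
apply: ler_sum => i _; apply: ler_sum => j _.
rewrite /proj_acc mul_mx_diag !mxE; case: (_ \in _).
  by rewrite mulr1.
by rewrite mulr0 !sqr_normc /= expr0n addr0 addr_ge0 ?sqr_ge0.
Qed.

(** * Recurrence of unitary orbits *)

Lemma pigeonhole_close (R : realType) (J : finType) (f : nat -> J -> R) (N : nat) :
    (0 < N)%N -> (forall n c, `|f n c| <= 1) ->
  exists i j, (i < j)%N /\ forall c, `|f i c - f j c| <= N%:R^-1.
Proof.
move=> N0 f_bounded.
have N0' : 0 < N%:R :> R by rewrite ltr0n.
(* Cells of width 1/N: [f n c + 1] lies in [0, 2], and the extra cell holds the endpoint 2. By
   [small] below, [inord] never takes its default value. *)
pose T := {ffun J -> 'I_(N.*2).+1}.
pose box n : T := [ffun c => inord (Num.truncn (N%:R * (f n c + 1)))].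
have boxP n c : (box n c)%:R <= N%:R * (f n c + 1) < (box n c)%:R + 1.
  have /andP[lo hi] : -1 <= f n c <= 1 by rewrite -ler_norml.
  have y0 : 0 <= N%:R * (f n c + 1) by apply: mulr_ge0; [exact: ltW | lra].
  have /andP[tlo thi] := truncn_itv y0.
  have small : (Num.truncn (N%:R * (f n c + 1)) < (N.*2).+1)%N.
    rewrite ltnS -(ler_nat R) (le_trans tlo) // -muln2 natrM ler_pM2l //; lra.
  by rewrite ffunE inordK // tlo natr1 thi.
have /injectivePn[i [j ij boxE]] : ~~ injectiveb (fun i : 'I_(#|T|.+1) => box i).
  apply/negP => /injectiveP /leq_card; rewrite card_ord ltnn //.
have close (a b : nat) c : box a = box b -> `|f a c - f b c| <= N%:R^-1.
  move=> abE; have := boxP a c; rewrite abE => /andP[alo ahi].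
  have /andP[blo bhi] := boxP b c.
  rewrite -(ler_pM2l N0') divff ?gt_eqF // -[X in X * _](gtr0_norm N0') -normrM.
  by rewrite ler_norml; apply/andP; split; lra.
have [lt_ij | lt_ji | eq_ij] := ltngtP i j.
- by exists i, j; split => // c; exact: close.
- by exists j, i; split => // c; exact: close.
- by rewrite (ord_inj eq_ij) eqxx in ij.
Qed.

(** Two points of the bounded orbit are close by pigeonhole; as [U] is an isometry, the earlier one
    can be pulled back to [v]. *)
Lemma unitary_recurrence (R : realType) (d : nat) (v : 'rV[R[i]]_d)
    (U : 'M[R[i]]_d) (delta : R) :
    U \is unitarymx -> sqnorm v = 1 -> 0 < delta ->
  exists2 n, (0 < n)%N & sqnorm (iter n (mulmxr U) v - v) < delta.
Proof.
move=> U_unitary v1 delta0.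
have iterB n (w w' : 'rV[R[i]]_d) : iter n (mulmxr U) (w - w') =
    iter n (mulmxr U) w - iter n (mulmxr U) w'.
  by elim: n => //= n ->; rewrite mulmxBl.
have iter_norm n (w : 'rV[R[i]]_d) : sqnorm (iter n (mulmxr U) w) = sqnorm w.
  by elim: n => //= n <-; exact: sqnorm_mul_unitary.
pose f n (c : bool * 'I_d) := let z := iter n (mulmxr U) v 0 c.2 in
  if c.1 then complex.Re z else complex.Im z.
have f_bounded n c : `|f n c| <= 1.
  have := iter_norm n v; rewrite v1 /sqnorm big_ord1 (bigD1 c.2) //= sqr_normc.
  set s := \sum_(_ | _) _ => eq1.
  have s0 : 0 <= s.
    by apply: sumr_ge0 => j _; rewrite sqr_normc addr_ge0 ?sqr_ge0.
  rewrite -(@ler_pXn2r _ 2) ?nnegrE // expr1n real_normK ?num_real // /f.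
  have := sqr_ge0 (complex.Re (iter n (mulmxr U) v 0 c.2)).
  have := sqr_ge0 (complex.Im (iter n (mulmxr U) v 0 c.2)).
  by case: (c.1) => ? ?; lra.
(* Each of the [d] complex coordinates contributes at most 2/N to the squared distance, using 1/N^2
   <= 1/N for both real parts. *)
pose N := (Num.truncn (d.*2%:R / delta)).+1.
have N1 : 1 <= N%:R :> R by rewrite ler1n.
have N_large : d.*2%:R < N%:R * delta.
  by rewrite -ltr_pdivrMr //; apply: truncnS_gt.
have [i [j [lt_ij close]]] := pigeonhole_close (isT : (0 < N)%N) f_bounded.
exists (j - i)%N; first by rewrite subn_gt0.
rewrite -(iter_norm i) iterB -iterD subnKC ?(ltnW lt_ij) //.
rewrite /sqnorm big_ord1.
have coord (c : 'I_d) : ComplexField.Normc.normc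
    ((iter j (mulmxr U) v - iter i (mulmxr U) v) 0 c) ^+ 2 <= 2 * N%:R^-1.
  have sq (x y : R) : `|x - y| <= N%:R^-1 -> (y - x) ^+ 2 <= N%:R^-1.
    move=> xy; rewrite -sqrrN opprB -real_normK ?num_real // expr2.
    apply: le_trans (_ : N%:R^-1 * 1 <= _); last by rewrite mulr1.
    apply: ler_pM => //; apply: le_trans xy _.
    by rewrite invf_le1 // (lt_le_trans ltr01).
  rewrite sqr_normc !mxE.
  have := sq _ _ (close (true, c)); have := sq _ _ (close (false, c)).
  rewrite /f /=.
  case: (iter i (mulmxr U) v _ _) => [a a'].
  case: (iter j (mulmxr U) v _ _) => [b b'] /= ? ?; lra.
apply: le_lt_trans (ler_sum _ (fun c _ => coord c)) _.
rewrite sumr_const card_ord -[ltLHS]mulr_natr mulrAC -natrM mul2n ltr_pdivrMr //.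
  by rewrite mulrC.
Qed.

(** * Windows and runs *)

Lemma nth_window (Sigma : finType) (k : nat) (x : seq Sigma) (i t : nat) :
  (t < k)%N -> nth None (window k x i) t = letter x (i%:Z - k%:Z + 1 + t%:Z).
Proof. by move=> tk; rewrite -(tnth_nth _ _ (Ordinal tk)) tnth_mktuple. Qed.

(** Over a one-letter alphabet this determines the extended letter completely. *)
Lemma letter_isSome (Sigma : finType) (x : seq Sigma) (j : int) :
  isSome (letter x j) = (0 < j) && (j <= (size x)%:Z).
Proof.
case: j => [[|p]|p] //=.
by rewrite onthTE.
Qed.

Lemma letter_rcons (Sigma : finType) (x : seq Sigma) (a : Sigma) (j : int) :
  j <= (size x)%:Z -> letter (rcons x a) j = letter x j.
Proof.
by case: j => [[|p]|p] //= px; rewrite -cats1 onth_cat ifT.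
Qed.

(** Windows look only backwards, so appending a letter leaves the earlier factors unchanged. *)
Lemma mubar_rcons (R : realType) (Sigma : finType) (k : nat)
    (A : qfa R Sigma k) (x : seq Sigma) (a : Sigma) :
  mubar A (rcons x a) =
    mubar A x *m qfa_mu A (window k (rcons x a) (size x).+1).
Proof.
have mubarE y : mubar A y = \prod_(1 <= i < (size y).+1) qfa_mu A (window k y i).
  by [].
rewrite !mubarE size_rcons big_nat_recr //=; congr (_ *m _).
apply: eq_big_nat => i /andP[i0 ix]; congr (qfa_mu A _).
apply: (@eq_from_tnth _ _) => t; rewrite !tnth_mktuple letter_rcons //.
by have := ltn_ord t; lia.
Qed.

Lemma mubar_unitary (R : realType) (Sigma : finType) (k : nat)
    (A : qfa R Sigma k) (x : seq Sigma) : mubar A x \is unitarymx.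
Proof.
elim/last_ind: x => [|x a IH].
  by rewrite /mubar big_geq //; apply/unitarymxP; rewrite mul1mx trmx1 map_mx1.
by rewrite mubar_rcons mul_unitarymx ?qfa_mu_unitary.
Qed.

Definition qfa_lift (R : realType) (Sigma : finType) (k : nat)
    (A : qfa R Sigma k) : qfa R Sigma k.+1 :=
  Qfa (qfa_acc A) (qfa_init_unit A)
    (fun w : k.+1.-tuple (option Sigma) =>
       qfa_mu_unitary A (behead_tuple w)).

Lemma acc_prob_lift (R : realType) (Sigma : finType) (k : nat)
    (A : qfa R Sigma k) (x : seq Sigma) :
  acc_prob (qfa_lift A) x = acc_prob A x.
Proof.
suff mubarE : mubar (qfa_lift A) x = mubar A x by rewrite /acc_prob mubarE.
apply: eq_bigr => i _ /=; congr (qfa_mu A _).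
apply: (@eq_from_tnth _ _) => t; rewrite tnth_behead !tnth_mktuple.
by congr letter; rewrite inordK ?ltnS //; case: t => t /= _; lia.
Qed.

(** * The separating language and its lower bound *)

Definition step_language (m : nat) : language :=
  @Language unit [set x | (m <= size x)%N]%classic.

Lemma step_language_not_accepted (R : realType) (m : nat) :
  (0 < m)%N -> ~ L_QFA R m (step_language m).
Proof.
case: m => // m _ [A [lambda [eps [_ eps0 inL notinL]]]].
pose U := qfa_mu A (nseq_tuple m.+1 (Some tt)).
pose v := (qfa_init A)^t* *m mubar A (nseq m tt).
have v1 : sqnorm v = 1.
  by rewrite sqnorm_mul_unitary ?mubar_unitary // sqnorm_adj qfa_init_unit.
(* With [m] now lowered by one, windows have length [m.+1]; beyond the first [m] letters they
   contain no blank. *)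
have iterE n : (qfa_init A)^t* *m mubar A (nseq (m + n) tt)
             = iter n (mulmxr U) v.
  elim: n => [|n IH]; first by rewrite addn0.
  have -> : nseq (m + n.+1) tt = rcons (nseq (m + n) tt) tt.
    by rewrite -cats1 -(nseqD _ 1) addn1 addnS.
  rewrite mubar_rcons mulmxA IH /= /mulmxr; congr (_ *m qfa_mu A _).
  apply: (@eq_from_tnth _ _) => t; rewrite tnth_mktuple tnth_nseq.
  have := letter_isSome (rcons (nseq (m + n) tt) tt)
    ((size (nseq (m + n) tt)).+1%:Z - m.+1%:Z + 1 + (t : nat)%:Z).
  rewrite size_rcons size_nseq.
  case: letter => [[]|] //= /esym/negbT.
  by have := ltn_ord t; lia.
(* This is the error coefficient of [sqnorm_le_near] at [t = eps]; recurrence within [eps] divided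
   by it makes the error term less than [eps]. *)
have c0 : 0 < 1 + eps^-1 by rewrite addr_gt0 // invr_gt0.
have [n n0] := unitary_recurrence (qfa_mu_unitary A (nseq_tuple m.+1 (Some tt)))
  v1 (divr_gt0 eps0 c0).
rewrite ltr_pdivlMr // mulrC => near.
have acc_in : lambda + eps <= sqnorm (iter n (mulmxr U) v *m proj_acc A).
  by rewrite -iterE; apply: inL => /=; rewrite size_nseq; lia.
have acc_notin : sqnorm (v *m proj_acc A) <= lambda - eps.
  by apply: notinL => /=; rewrite size_nseq; lia.
have acc1 : sqnorm (v *m proj_acc A) <= 1.
  by rewrite -v1 sqnorm_mul_proj_acc.
have := sqnorm_le_near (iter n (mulmxr U) v *m proj_acc A) (v *m proj_acc A) eps0.
rewrite -mulmxBl => upper.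
have proj_near := sqnorm_mul_proj_acc (iter n (mulmxr U) v - v) (A := A).
have small := le_lt_trans (ler_wpM2l (ltW c0) proj_near) near.
(* The upper bound is less than (lambda - eps) + eps + eps = lambda + eps, a contradiction. *)
have := le_trans acc_in upper; apply/negP; rewrite -ltNge mulrDl mul1r.
have le_eps : eps * sqnorm (v *m proj_acc A) <= eps by rewrite ler_piMr // ltW.
apply: lt_le_trans (_ : (lambda - eps + eps) + eps <= _); last by rewrite subrK.
by apply: ler_ltD; [exact: lerD | exact: small].
Qed.

(** * A two-state automaton for the separating language *)

Section StepQfa.
Variables (R : realType) (m : nat).

Definition step_vec (b : bool) : 'rV[R[i]]_#|{: bool}| := delta_mx 0 (enum_rank b).

(** In a run, entries 0 and 1 of the window ending at [i] are at positions [i - m - 1] and [i - m],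
    so the swap fires only at [i = m.+1]. *)
Definition step_mu (w : m.+2.-tuple (option unit)) : 'M[R[i]]_#|{: bool}| :=
  if ~~ isSome (nth None w 0) && isSome (nth None w 1)
  then perm_mx (tperm (enum_rank false) (enum_rank true)) else 1%:M.

Lemma sqnorm_step_vec (b : bool) : sqnorm (step_vec b) = 1.
Proof.
apply: (@complexI R); rewrite sqnorm_trace trmx_delta map_delta_mx.
by rewrite mul_delta_mx /mxtrace big_ord1 mxE.
Qed.

Lemma step_mu_unitary w : step_mu w \is unitarymx.
Proof.
apply/unitarymxP; rewrite /step_mu; case: ifP => _.
  by rewrite tr_perm_mx map_perm_mx -perm_mxM mulgV perm_mx1.
by rewrite trmx1 map_mx1 mulmx1.
Qed.

Lemma sqnorm_step_init : sqnorm ((step_vec false)^t*) = 1.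
Proof. by rewrite sqnorm_adj sqnorm_step_vec. Qed.

Definition step_qfa : qfa R unit m.+2 :=
  Qfa [set true] sqnorm_step_init step_mu_unitary.

Lemma step_qfa_run (x : seq unit) :
  (qfa_init step_qfa)^t* *m mubar step_qfa x = step_vec (m < size x)%N.
Proof.
elim/last_ind: x => [|x a IH].
  rewrite /mubar big_geq // mulmx1 /=.
  by apply/matrixP => i j; rewrite !mxE conjCK.
rewrite mubar_rcons mulmxA IH /= /step_mu !nth_window // !letter_isSome.
(* The letter being read has position [(size x).+1], so [jump] forces [size x = m]. *)
rewrite size_rcons; case: ifP => [jump|stay].
  have -> : (m < size x)%N = false by lia.
  have -> : (m < (size x).+1)%N by lia.
  by rewrite /step_vec -rowE; apply/rowP => j; rewrite !mxE tpermL eq_sym.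
rewrite mulmx1; congr step_vec; lia.
Qed.

(** The run ends in a basis vector, so the projector keeps it or kills it. *)
Lemma acc_prob_step_qfa (x : seq unit) :
  acc_prob step_qfa x = (m < size x)%N%:R.
Proof.
rewrite /acc_prob step_qfa_run /proj_acc /step_vec -rowE.
rewrite /sqnorm big_ord1 (bigD1 (enum_rank (m < size x)%N)) //= big1 => [|j ji].
  rewrite !mxE eqxx mulr1n enum_rankK !sqr_normc inE addr0.
  by case: (m < size x)%N => /=; rewrite !expr0n ?expr1n ?addr0.
by rewrite !mxE eq_sym (negbTE ji) mulr0n sqr_normc /= expr0n addr0.
Qed.

End StepQfa.

Theorem corollary4 (R : realType) (k : nat) (hk : (2 <= k)%N) :
  (forall L : language, L_QFA R (k - 1)%N L -> L_QFA R k L) /\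
  (exists L : language, L_QFA R k L /\ ~ L_QFA R (k - 1)%N L).
Proof.
case: k hk => [|[|m]] // _; rewrite subn1 /=; split.
  move=> L [A [lambda [eps [lambda01 eps0 inL notinL]]]].
  exists (qfa_lift A); exists lambda, eps.
  split; [exact: lambda01 | exact: eps0 | move=> x | move=> x];
    rewrite acc_prob_lift; [exact: inL | exact: notinL].
exists (step_language m.+1); split; last exact: step_language_not_accepted.
(* The probabilities are exactly 1 and 0, hence cut point and margin 1/2. *)
exists (step_qfa R m), 2^-1, 2^-1; split; rewrite /step_language /=; first lra.
- by rewrite invr_gt0 ltr0n.
- by move=> x mx; rewrite acc_prob_step_qfa mx -div1r -splitr.
- by move=> x /negP /negbTE mx; rewrite acc_prob_step_qfa mx subrr.
Qed.
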